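(* Let $\{f_l\}_{l\in L}$ be an abstract pCFG with priority partition $\{P_{l,i}\}_{l\in L,1\le i\le d}$, and run the synthesis algorithm described in the context with any procedure $\textsc{Solve}$ that always returns measurable functions satisfying all constraints of its first argument $c_0$. If the algorithm returns a family $\{r_{(l,i),j,k}\}$, then there exist $\{m_j\}$ and $\mathrm{lev}$ such that $(\{m_j\},\mathrm{lev},\{r_{(l,i),j,k}\})$ is a LexPMSM map for the pCFG.
   Context: Setting: an abstract pCFG is a family of Markov kernels $f_l:\mathbb{R}^n\to\mathcal{G}(L\times\mathbb{R}^n)$ ($L$ finite), inducing the Markov chain $F(l,x)=f_l(x)$ on $L\times\mathbb{R}^n$ with $(\mathbb{X}g)(s)=\int g\,dF_s$; a priority partition is a family of measurable $P_{l,i}\subseteq\mathbb{R}^n$ with $\{P_{l,i}\}_{i=1}^d$ a partition of $\mathbb{R}^n$ for each $l$. For a family $R=\{R_{l,i}:\mathbb{R}^n\to[0,\infty)\}$ let $\hat R(l,x)=\sum_i[x\in P_{l,i}]R_{l,i}(x)$. LexPMSM map: positive integers $m_j$ ($1\le j\le\lceil d/2\rceil$), $\mathrm{lev}:L\times\{1,\dots,d\}\to\mathbf{Lev}\cup\{\star\}$ with $\mathbf{Lev}=\{(j,k)\mid 1\le k\le m_j\}$ ordered lexicographically, and measurable $r_{(l,i),j,k}:\mathbb{R}^n\to[0,\infty)$, with $r_{j,k}=\widehat{\{r_{(l,i),j,k}\}_{l,i}}$, such that: if $\mathrm{lev}(l,i)=(j,k)$ then $j\le\lceil i/2\rceil$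 and for all $x\in P_{l,i}$, $r_{j',k'}(l,x)\ge(\mathbb{X}r_{j',k'})(l,x)$ for all $(j',k')<_{\mathrm{lex}}(j,k)$ and $r_{j,k}(l,x)\ge1+(\mathbb{X}r_{j,k})(l,x)$; if $\mathrm{lev}(l,i)=\star$ then $i$ is even and $r_{j,k}(l,x)\ge(\mathbb{X}r_{j,k})(l,x)$ for all $j\le\lceil i/2\rceil$, $k\le m_j$, $x\in P_{l,i}$. Algorithm: set $T=L\times\{1,\dots,d\}$. For $j=1,\dots,\lceil d/2\rceil$: remove from $T$ all $(l,i)$ with $i<2j-1$; then repeat: let $c_0$ be the constraints ''$\forall x\in P_{l,i}$, $R_{l,i}(x)\ge(\mathbb{X}\hat R)(l,x)$'' for $(l,i)\in T$ together with $R_{l,i}\ge0$ on $P_{l,i}$ for all $(l,i)$, and $c_1$ the constraints ''$\forall x\in P_{l,i}$, $R_{l,i}(x)\ge1+(\mathbb{X}\hat R)(l,x)$'' for $(l,i)\in T$; let $R=\textsc{Solve}(c_0,c_1)$; let $T'$ be the set of $(l,i)\in T$ whose $c_1$-constraint $R$ satisfies; set $T\leftarrow T\setminus T'$; if $T'\neq\emptyset$, append $R$ as the next component $r_{\cdot,j,k}$ of block $j$ and repeat; else stop the inner loop. After the inner loop, if some $(l,2j-1)$ remains in $T$, output ''no LexPMSM map found'' and stop; if block $j$ received no component, set $m_j=1$ and its single component to the zero function, else $m_j$ is the number of appended components. After all $j$, return the family $\{r_{(l,i),j,k}\}$. *)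

(* Defs.v *)
From HB Require Import structures.
From mathcomp Require Import all_boot all_order all_algebra.
From mathcomp Require Import all_classical all_reals all_analysis.

Set Implicit Arguments.
Unset Strict Implicit.
Unset Printing Implicit Defensive.
Import Order.TTheory GRing.Theory Num.Theory.
Local Open Scope classical_set_scope.
Local Open Scope ring_scope.

(* [L] with its discrete sigma-algebra. A [measurableType] must be pointed; the
   index [l] only supplies this point, so that no nonemptiness assumption on
   [L] is needed. *)
Definition discr_at (L : finType) (l : L) : Type := L.

HB.instance Definition _ (L : finType) (l : L) := Finite.on (discr_at l).
HB.instance Definition _ (L : finType) (l : L) :=
  isPointed.Build (discr_at l) l.
HB.instance Definition _ (L : finType) (l : L) :=
  @isMeasurable.Build default_measure_display (discr_at l)
    discrete_measurable discrete_measurable0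
    discrete_measurableC discrete_measurableU.

Section LexPMSM.
Context {R : realType} {n d : nat} {L : finType}.

Local Notation Rn := (n.-tuple R).

(* R^n carries the product sigma-algebra of [n.-tuple R], i.e. its Borel sets. *)
Definition pCFG := forall l : L, R.-pker Rn ~> (discr_at l * Rn)%type.

Definition chain (f : pCFG) (s : L * Rn) :
  {measure set (discr_at s.1 * Rn) -> \bar R} := f s.1 s.2.

Definition preexp (f : pCFG) (g : L * Rn -> R) (s : L * Rn) : \bar R :=
  (\int[chain f s]_y (g y)%:E)%E.

(* The ordinal [i : 'I_d] (0, ..., d-1) stands for the priority i + 1. *)
Definition prio (i : 'I_d) : nat := i.+1.

Definition priority_partition (P : L -> 'I_d -> set Rn) : Prop :=
  forall l, [/\ forall i, measurable (P l i),
                trivIset [set: 'I_d] (P l)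
              & \bigcup_i P l i = [set: Rn]].

Definition rfamily := L -> 'I_d -> Rn -> {nonneg R}.

Definition measurable_family (F : rfamily) : Prop :=
  forall l i, measurable_fun [set: Rn] (fun x => (F l i x)%:num).

Definition zero_family : rfamily := fun _ _ _ => 0%:nng.

Definition hat (P : L -> 'I_d -> set Rn) (F : rfamily) (s : L * Rn) : R :=
  \sum_(i < d) \1_(P s.1 i) s.2 * (F s.1 i s.2)%:num.

Section Constraints.
Variables (f : pCFG) (P : L -> 'I_d -> set Rn).

Definition nonincreasing_on (g : L * Rn -> R) (s : L * 'I_d) : Prop :=
  forall x, P s.1 s.2 x -> (preexp f g (s.1, x) <= (g (s.1, x))%:E)%E.

Definition ranking_on (g : L * Rn -> R) (s : L * 'I_d) : Prop :=
  forall x, P s.1 s.2 x -> (1 + preexp f g (s.1, x) <= (g (s.1, x))%:E)%E.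

(* m_j is [m j] for 1 <= j <= ceil(d/2); [uphalf a] is ceil(a/2). *)
Definition Lev (m : nat -> nat) (p : nat * nat) : bool :=
  (1 <= p.1 <= uphalf d)%N && (1 <= p.2 <= m p.1)%N.

Definition lt_lex (p q : nat * nat) : bool :=
  ((p : (nat *l nat)%type) < q)%O.

(* A family {r_{(l,i),j,k}}, where j <= ceil(d/2) and k ranges over an initial
   segment depending on j, is the sequence of its blocks j = 1, 2, ..., each
   block being the sequence of its components k = 1, 2, ... *)
Definition block (r : seq (seq rfamily)) (j : nat) : seq rfamily :=
  nth [::] r j.-1.

Definition family_at (r : seq (seq rfamily)) (p : nat * nat) : rfamily :=
  nth zero_family (block r p.1) p.2.-1.

(* [lev l i = None] encodes lev(l,i) = star. *)
Record is_LexPMSM (m : nat -> nat) (lev : L -> 'I_d -> option (nat * nat))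
    (r : seq (seq rfamily)) : Prop := IsLexPMSM {
  LexPMSM_m_gt0 : forall j, (1 <= j <= uphalf d)%N -> (0 < m j)%N;
  LexPMSM_blocks : size r = uphalf d;
  LexPMSM_components :
    forall j, (1 <= j <= uphalf d)%N -> size (block r j) = m j;
  LexPMSM_measurable : forall p, Lev m p -> measurable_family (family_at r p);
  LexPMSM_lev : forall l i p, lev l i = Some p -> Lev m p;
  LexPMSM_some : forall l i j k, lev l i = Some (j, k) ->
    [/\ (j <= uphalf (prio i))%N,
        forall p, Lev m p -> lt_lex p (j, k) ->
          nonincreasing_on (hat P (family_at r p)) (l, i)
      & ranking_on (hat P (family_at r (j, k))) (l, i)];
  LexPMSM_star : forall l i, lev l i = None ->
    ~~ odd (prio i) /\
    forall j k, Lev m (j, k) -> (j <= uphalf (prio i))%N ->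
      nonincreasing_on (hat P (family_at r (j, k))) (l, i)
}.

Definition constraint := rfamily -> Prop.

(* Automatic here, since the values of an [rfamily] are in [0, +oo[. *)
Definition nonneg_constraint (s : L * 'I_d) : constraint := fun F =>
  forall x, P s.1 s.2 x -> 0 <= (F s.1 s.2 x)%:num.

Definition weak_constraint (s : L * 'I_d) : constraint := fun F =>
  forall x, P s.1 s.2 x ->
    (preexp f (hat P F) (s.1, x) <= ((F s.1 s.2 x)%:num)%:E)%E.

Definition strict_constraint (s : L * 'I_d) : constraint := fun F =>
  forall x, P s.1 s.2 x ->
    (1 + preexp f (hat P F) (s.1, x) <= ((F s.1 s.2 x)%:num)%:E)%E.

Definition c0 (T : {set L * 'I_d}) : set constraint :=
  [set weak_constraint s | s in [set` T]] `|` range nonneg_constraint.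

Definition c1 (T : {set L * 'I_d}) : set constraint :=
  [set strict_constraint s | s in [set` T]].

(* [Solve a b F]: the call Solve(a, b) may return F. A relation also covers
   procedures whose answer is not determined by the two arguments. *)
Definition solver := set constraint -> set constraint -> rfamily -> Prop.

(* Restricted to the calls the algorithm can make: no procedure could satisfy
   an arbitrary, possibly contradictory, first argument. *)
Definition sound_solver (Solve : solver) : Prop :=
  forall (T : {set L * 'I_d}) (F : rfamily), Solve (c0 T) (c1 T) F ->
    measurable_family F /\ forall c, c0 T c -> c F.

Definition ranked (T : {set L * 'I_d}) (F : rfamily) : {set L * 'I_d} :=
  [set s in T | `[< strict_constraint s F >]]%SET.

(* [inner_loop Solve T T1 Fs]: the inner loop started with T can stop with
   T1, having appended the components Fs in this order. *)
Inductive inner_loop (Solve : solver) :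
    {set L * 'I_d} -> {set L * 'I_d} -> seq rfamily -> Prop :=
| inner_stop T F :
    Solve (c0 T) (c1 T) F -> ranked T F = finset.set0 ->
    inner_loop Solve T T [::]
| inner_next T F T1 Fs :
    Solve (c0 T) (c1 T) F -> ranked T F <> finset.set0 ->
    inner_loop Solve (T :\: ranked T F)%SET T1 Fs ->
    inner_loop Solve T T1 (F :: Fs).

Definition prune (j : nat) (T : {set L * 'I_d}) : {set L * 'I_d} :=
  [set s in T | ~~ (prio s.2 < j.*2 - 1)%N]%SET.

Definition odd_left (j : nat) (T : {set L * 'I_d}) : bool :=
  [exists s in T, prio s.2 == j.*2 - 1]%N.

Definition close_block (Fs : seq rfamily) : seq rfamily :=
  if Fs is [::] then [:: zero_family] else Fs.

(* [outer_loop Solve j T res]: the iterations j, j+1, ..., ceil(d/2) started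
   with T can yield [res], where [None] is the answer "no LexPMSM map found"
   and [Some r] returns the blocks r of these iterations. *)
Inductive outer_loop (Solve : solver) :
    nat -> {set L * 'I_d} -> option (seq (seq rfamily)) -> Prop :=
| outer_done j T :
    (uphalf d < j)%N -> outer_loop Solve j T (Some [::])
| outer_fail j T T1 Fs :
    (j <= uphalf d)%N -> inner_loop Solve (prune j T) T1 Fs ->
    odd_left j T1 -> outer_loop Solve j T None
| outer_next j T T1 Fs res :
    (j <= uphalf d)%N -> inner_loop Solve (prune j T) T1 Fs ->
    ~~ odd_left j T1 -> outer_loop Solve j.+1 T1 res ->
    outer_loop Solve j T (omap (cons (close_block Fs)) res).

Definition synthesis (Solve : solver) (res : option (seq (seq rfamily))) :
  Prop := outer_loop Solve 1 [set: L * 'I_d]%SET res.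

End Constraints.
End LexPMSM.

Arguments pCFG : clear implicits.
Arguments rfamily : clear implicits.
Arguments solver : clear implicits.

(* Main.v *)
Require Import Defs.
From mathcomp Require Import all_boot all_order all_algebra.
From mathcomp Require Import all_classical all_reals all_analysis.
From mathcomp Require Import zify.

(** A pair [s = (l, i)] receives the level [(j, k)] when the [k]-th component of
    block [j] is the one that removes it from [T]; up to that point it was in
    every [T] passed to Solve, so all earlier components satisfy its weak
    constraint. A pair never removed this way gets the level star: it leaves by
    pruning at the start of block [j], or survives the last block. In both cases
    its priority exceeds [2j' - 1] for the last block [j'] it took part in,
    because no odd priority is left after a successful block, so its priority is
    the even number [2j']. *)

Import Order.TTheory GRing.Theory Num.Theory.
Set Implicit Arguments.
Unset Strict Implicit.
Unset Printing Implicit Defensive.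
Local Open Scope classical_set_scope.
Local Open Scope ring_scope.

Section Soundness.
Context {R : realType} {n d : nat} {L : finType}.
Variables (f : pCFG R n L) (P : L -> 'I_d -> set (n.-tuple R)).

Local Notation zero := (zero_family : rfamily R n d L).

(** The constraints bound [F l i x], the map conditions bound [hat P F]; disjointness leaves only
    the summand [i] on [P l i], so the two agree there. *)
Lemma hat_on F l i x : trivIset [set: 'I_d] (P l) -> P l i x ->
  hat P F (l, x) = (F l i x)%:num.
Proof.
move=> tP Px; rewrite /hat (bigD1 i)//= big1 ?addr0 => [|i' i'i].
  by rewrite indicE mem_set// mul1r.
rewrite indicE memNset ?mul0r// => Px'.
by move/eqP: i'i; apply; apply: tP => //; exists x.
Qed.

Lemma nonincreasing_zero s : nonincreasing_on f P (hat P zero) s.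
Proof.
have h0 t : hat P zero t = 0 by rewrite /hat big1// => i _; rewrite mulr0.
by move=> x _; rewrite /preexp integral0_eq ?h0// => y _; rewrite h0.
Qed.

Lemma measurable_zero : measurable_family zero.
Proof. by move=> l i; exact: measurable_cst. Qed.

Hypothesis partP : priority_partition P.

Lemma weak_nonincreasing s F :
  weak_constraint f P s F -> nonincreasing_on f P (hat P F) s.
Proof.
case: s => l i wF x Px; have [_ tP _] := partP l.
by rewrite (hat_on _ tP Px); exact: wF.
Qed.

Lemma strict_ranking s F :
  strict_constraint f P s F -> ranking_on f P (hat P F) s.
Proof.
case: s => l i wF x Px; have [_ tP _] := partP l.
by rewrite (hat_on _ tP Px); exact: wF.
Qed.

Variable Solve : solver R n d L.
Hypothesis soundS : sound_solver f P Solve.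

Lemma inner_loop_measurable T T1 Fs b :
  inner_loop f P Solve T T1 Fs -> measurable_family (nth zero Fs b).
Proof.
move=> run; elim: run b => [{}T F _ _|{}T F {}T1 {}Fs /soundS[mF _] _ _ IH] b.
  by rewrite nth_nil; exact: measurable_zero.
by case: b => [|b] /=.
Qed.

Lemma inner_loop_level T T1 Fs s : inner_loop f P Solve T T1 Fs -> s \in T ->
  (s \in T1 /\ forall b, nonincreasing_on f P (hat P (nth zero Fs b)) s) \/
  exists b, [/\ (b < size Fs)%N,
    ranking_on f P (hat P (nth zero Fs b)) s &
    forall b', (b' < b)%N -> nonincreasing_on f P (hat P (nth zero Fs b')) s].
Proof.
elim=> [{}T F _ _|{}T F {}T1 {}Fs /soundS[_ c0F] _ _ IH] sT.
  by left; split=> // b; rewrite nth_nil; exact: nonincreasing_zero.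
(* Since [s] is still in [T], its weak constraint belongs to [c0 T], whether or not [F] ranks
   [s]. *)
have wF : nonincreasing_on f P (hat P F) s.
  by apply: weak_nonincreasing; apply: c0F; left; exists s.
have [|sF] := boolP (s \in ranked f P T F).
  rewrite !inE => /andP[_ /asboolP sF].
  by right; exists 0%N; split=> //=; exact: strict_ranking.
have [|[sT1 nFs]|[b [bFs rb nb]]] := IH; first by rewrite finset.in_setD sF.
- by left; split=> // -[|b] /=.
- by right; exists b.+1; split=> // -[|b'] //=; exact: nb.
Qed.

(* Indices are shifted to start at 0; an index out of range denotes the zero
   family, which is harmless in the nonincreasing clauses. *)
Definition component (r : seq (seq (rfamily R n d L))) (a b : nat) :
  rfamily R n d L := nth zero (nth [::] r a) b.

(** The zero family put into an empty block is also the default value of [nth]. *)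
Lemma nth_close_block (Fs : seq (rfamily R n d L)) b :
  nth zero (close_block Fs) b = nth zero Fs b.
Proof. by case: Fs => //; case: b => // b; rewrite /= !nth_nil. Qed.

Lemma size_close_block (Fs : seq (rfamily R n d L)) :
  size (close_block Fs) = maxn 1 (size Fs).
Proof. by case: Fs => //= F Fs; rewrite maxnE subn1 add1n. Qed.

Lemma outer_loop_shape j T r :
  outer_loop f P Solve j T (Some r) -> (j <= (uphalf d).+1)%N ->
  [/\ size r = ((uphalf d).+1 - j)%N,
      forall a, (a < size r)%N -> (0 < size (nth [::] r a))%N &
      forall a b, measurable_family (component r a b)].
Proof.
move E: (Some r) => res run; elim: run r E => {j T res}.
- move=> j T dj r [->] jd; split=> //= [|a b]; first by lia.
  by rewrite /component !nth_nil; exact: measurable_zero.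
- by [].
- move=> j T T1 Fs [r'|//] jd run _ _ IH _ [->] _.
  have [||sr nr mr] := IH r' => //.
  split=> [/=|[|a]|[|a] b]; first by rewrite sr; lia.
  + by rewrite /= size_close_block leq_max.
  + exact: nr.
  + by rewrite /component /= nth_close_block; exact: inner_loop_measurable run.
  + exact: mr.
Qed.

(** The invariant is that pairs left at the start of iteration [j] have priority at least 2j - 2.
    Position [a] in [r] is block [j + a] of the whole run. *)
Lemma outer_loop_level j T r s :
  outer_loop f P Solve j T (Some r) -> (0 < j <= (uphalf d).+1)%N ->
  s \in T -> (j.*2 <= (prio s.2).+2)%N ->
  (exists a b, [/\ (a < size r)%N, (b < size (nth [::] r a))%N,
      (j + a <= uphalf (prio s.2))%N,
      ranking_on f P (hat P (component r a b)) s &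
      forall a' b', (a' < a)%N || (a' == a) && (b' < b)%N ->
        nonincreasing_on f P (hat P (component r a' b')) s]) \/
  (~~ odd (prio s.2) /\ forall a b, (j + a <= uphalf (prio s.2))%N ->
      nonincreasing_on f P (hat P (component r a b)) s).
Proof.
move E: (Some r) => res run; elim: run r E => {j T res}.
- move=> j T dj r [->] jd sT js; right; split.
    (* Here 2j - 2 is at least 2 ceil(d/2), while the priority is at most d, so both equal d, which
       is then even. *)
    by have := ltn_ord s.2; move: js; rewrite /prio; lia.
  by move=> a b _; rewrite /component !nth_nil; exact: nonincreasing_zero.
- by [].
- move=> j T T1 Fs [r'|//] jd run noodd _ IH _ [->] j0 sT js.
  have [sp|] := boolP (s \in prune j T); last first.
    (* A pruned pair has priority exactly 2j - 2, so no block from [j] on is constrained at it. *)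
    rewrite inE sT andTb negbK => sj; right; split; first by lia.
    by move=> a b; lia.
  have js' : (j.*2 - 1 <= prio s.2)%N by move: sp; rewrite inE sT /= -leqNgt.
  have [[sT1 nFs]|[b [bFs rb nb]]] := inner_loop_level run sp; last first.
    left; exists 0%N, b; split=> //.
    + by rewrite /= size_close_block leq_max bFs orbT.
    + by lia.
    + by rewrite /component /= nth_close_block.
    + move=> [|a'] b' //= b'b.
      by rewrite /component /= nth_close_block; exact: nb.
  (* With [js'] this raises the priority to at least 2j, the invariant for [j.+1]. *)
  have neq : (prio s.2 != j.*2 - 1)%N.
    by apply: contra noodd => e; apply/existsP; exists s; rewrite sT1.
  have nF b : nonincreasing_on f P
      (hat P (component (close_block Fs :: r') 0 b)) s.
    by rewrite /component /= nth_close_block.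
  have [||||[a [b [ar br ja rab nab]]]|[ev nr]] := IH r' => //; first by lia.
  + by left; exists a.+1, b; split=> //; [lia|case=> [|a'] b' //; exact: nab].
  + right; split=> // -[|a] b // ja; apply: nr; lia.
Qed.

End Soundness.

Theorem theorem6p7 (R : realType) (n d : nat) (L : finType)
    (f : pCFG R n L) (P : L -> 'I_d -> set (n.-tuple R))
    (Solve : solver R n d L) (r : seq (seq (rfamily R n d L))) :
  priority_partition P ->
  sound_solver f P Solve ->
  synthesis f P Solve (Some r) ->
  exists (m : nat -> nat) (lev : L -> 'I_d -> option (nat * nat)),
    is_LexPMSM f P m lev r.
Proof.
move=> partP soundS run.
have [//|sr nr mr] := outer_loop_shape soundS run.
have E p : family_at r p = component r p.1.-1 p.2.-1 by [].
pose m j := size (block r j).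
(* The conditions on levels concern one pair at a time, so [lev] can be chosen pointwise. *)
pose spec (s : L * 'I_d) o := match o with
  | Some p => [/\ Lev (d := d) m p, (p.1 <= uphalf (prio s.2))%N,
        forall q, Lev (d := d) m q -> lt_lex q p ->
          nonincreasing_on f P (hat P (family_at r q)) s
      & ranking_on f P (hat P (family_at r p)) s]
  | None => ~~ odd (prio s.2) /\
      forall j k, Lev (d := d) m (j, k) -> (j <= uphalf (prio s.2))%N ->
        nonincreasing_on f P (hat P (family_at r (j, k))) s
  end.
have /choice[lev levP] s : exists o, spec s o.
  have [|||[a [b [ar br ja rab nab]]]|[ev nab]] :=
    outer_loop_level (s := s) partP soundS run => //.
  - exists (Some (a.+1, b.+1)); split=> //=.
    + by rewrite /Lev /m /block /= br; lia.
    (* [Lev] excludes a zero coordinate, so the predecessors in [family_at] lose nothing and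
       preserve the lexicographic order. *)
    + move=> [[|j] [|k]] //; rewrite /Lev //= ?andbF// => _.
      rewrite /lt_lex ltEprodlexi /= => jk; rewrite E; apply: nab => /=.
      move: jk; rewrite !leEnat ltEnat /=; lia.
  - exists None; split=> // -[//|j] k _ jd; rewrite E; apply: nab.
    by rewrite add1n.
exists m, (fun l i => lev (l, i)); split=> //.
- by case=> // j jd; apply: nr; rewrite sr; lia.
- by rewrite sr subn1.
- by move=> p _; exact: mr.
- by move=> l i p lp; have := levP (l, i); rewrite lp => -[].
- by move=> l i j k lp; have := levP (l, i); rewrite lp => -[].
- by move=> l i lp; have := levP (l, i); rewrite lp.
Qed.
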